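(* Let $d\geq 3$ be an integer and let $1\leq i_1<i_2<\cdots<i_q\leq d-2$ be integers (possibly $q=0$). Then there exists a $d$-dimensional integral convex polytope $\mathcal{P}\subset\mathbb{R}^d$ such that, in its Ehrhart polynomial $i(\mathcal{P},t)$, the coefficients of $t^{i_1},\ldots,t^{i_q}$ are negative while all remaining coefficients (of $t^j$ for $j\in\{0,1,\ldots,d\}\setminus\{i_1,\ldots,i_q\}$) are positive.
   Context: An integral convex polytope is the convex hull of finitely many points of $\mathbb{Z}^d$; it is $d$-dimensional if its affine hull is $\mathbb{R}^d$. For such a polytope $\mathcal{P}$, the Ehrhart polynomial $i(\mathcal{P},t)$ is the polynomial (of degree $d$) satisfying $i(\mathcal{P},t)=\#(t\mathcal{P}\cap\mathbb{Z}^d)$ for all positive integers $t$, where $t\mathcal{P}=\{t\alpha:\alpha\in\mathcal{P}\}$. *)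

(* Defs.v *)
From mathcomp Require Export all_boot all_order all_algebra.
From mathcomp Require Export all_classical reals.

Set Implicit Arguments.
Unset Strict Implicit.
Unset Printing Implicit Defensive.

Import Order.TTheory GRing.Theory Num.Theory.

Local Open Scope classical_set_scope.
Local Open Scope card_scope.
Local Open Scope ring_scope.

Definition convex_hull (R : realType) (d : nat) (A : set 'rV[R]_d) :
    set 'rV[R]_d :=
  [set x | exists (n : nat) (v : 'I_n -> 'rV[R]_d) (a : 'I_n -> R),
     [/\ forall i, A (v i), forall i, 0 <= a i, \sum_(i < n) a i = 1
       & x = \sum_(i < n) a i *: v i]].

Definition affine_hull (R : realType) (d : nat) (A : set 'rV[R]_d) :
    set 'rV[R]_d :=
  [set x | exists (n : nat) (v : 'I_n -> 'rV[R]_d) (a : 'I_n -> R),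
     [/\ forall i, A (v i), \sum_(i < n) a i = 1
       & x = \sum_(i < n) a i *: v i]].

Definition integer_lattice (R : realType) (d : nat) : set 'rV[R]_d :=
  [set x | forall i : 'I_d, x ord0 i \is a Num.int].

Definition integral_convex_polytope (R : realType) (d : nat)
    (P : set 'rV[R]_d) : Prop :=
  exists V : set 'rV[R]_d,
    [/\ finite_set V, V `<=` @integer_lattice R d & P = convex_hull V].

Definition full_dimensional (R : realType) (d : nat) (P : set 'rV[R]_d) : Prop :=
  affine_hull P = setT.

Definition dilate (R : realType) (d : nat) (t : nat) (P : set 'rV[R]_d) :
    set 'rV[R]_d :=
  [set t%:R *: x | x in P].

(* A polynomial is determined by its values at the positive integers, so at
   most one p satisfies this for a given P. *)
Definition is_Ehrhart_polynomial (R : realType) (d : nat) (P : set 'rV[R]_d)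
    (p : {poly R}) : Prop :=
  size p = d.+1 /\
  forall t : nat, (0 < t)%N ->
    exists2 n : nat, dilate t P `&` @integer_lattice R d #= `I_n
                   & p.[t%:R] = n%:R.

(* Main.v *)
Require Import Defs.
From mathcomp Require Import zify lra ring.

Set Implicit Arguments.
Unset Strict Implicit.
Unset Printing Implicit Defensive.

Import Order.TTheory GRing.Theory Num.Theory.
Local Open Scope classical_set_scope.
Local Open Scope card_scope.
Local Open Scope ring_scope.

(** The polytope is built one coordinate at a time.  From a lattice polytope [P]
in dimension [d], with Ehrhart polynomial [p], pass to the prism
[P * [0, Lk]]; this multiplies [p] by [1 + Lkt].  Optionally press the top of
the prism down to height [0] above one smooth vertex of [P], by the inequality
[y <= k nu x], where the linear form [nu] vanishes at that vertex and
[nu <= L] cuts a lattice simplex off [P].  This subtracts [k] times a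
polynomial [G] that depends only on [L] and [d].  So the new coefficient of [t^(j+1)] is
[p_(j+1) + k (L p_j - G_(j+1))], or the same without [G].  If [k] is large and
[p_1, ..., p_d] are larger than the coefficients of [G], the signs of
[p_1, ..., p_d] move up by one place, while the sign of the new coefficient
of [t] is that of [L] without the cut and that of [L - G_1] with it.  One
coordinate of [P] enters [nu] with weight [1] and all others with weight [L];
this makes [G_1] quadratic in [L], so that [L - G_1 < 0] for large [L].

The cut takes place at the far end of the last coordinate axis, and the
construction leaves the corner at the origin and the far end of the new
coordinate untouched, so it can be iterated. *)

(** * Counting the lattice points of the dilates *)

Section LatticePoints.

Variable L : nat.

Local Open Scope nat_scope.

(** The argument counts the coordinates older than the weighted one, so only the oldest coordinate
    has weight [1]. *)
Definition weight (d : nat) : nat := if d is 0 then 1 else L.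

Fixpoint mu (x : seq nat) : nat :=
  if x is y :: x' then weight (size x') * y + mu x' else 0.

(* A polytope is encoded by the list of its pairs [(k, c)], the newest
   coordinate first; [c] tells whether the corner was cut when the coordinate was added. *)
Fixpoint valid (s : seq (nat * bool)) : bool :=
  if s is (k, c) :: s' then [&& 2 <= k, c ==> (2 <= size s') & valid s']
  else true.

(** This is [mu] after the reflection [y -> L * k * t - y] of the newest coordinate. On [pts] the
    subtraction never truncates. *)
Definition nu (s : seq (nat * bool)) (t : nat) (x : seq nat) : nat :=
  if s is (k, _) :: _ then
    if x is y :: x' then weight (size x') * (L * k * t - y) + mu x' else 0
  else 0.

Definition height (k : nat) (c : bool) s (t : nat) (x : seq nat) : nat :=
  if c then minn (L * k * t) (k * nu s t x) else L * k * t.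

Fixpoint pts (s : seq (nat * bool)) (t : nat) : seq (seq nat) :=
  if s is (k, c) :: s' then
    [seq y :: x | x <- pts s' t, y <- iota 0 (height k c s' t x).+1]
  else [:: [::]].

Lemma mem_pts_nil k c s t : [::] \notin pts ((k, c) :: s) t.
Proof. by apply/negP => /allpairsPdep[x [y [_ _]]]. Qed.

Lemma mem_pts_cons k c s t y x :
  (y :: x \in pts ((k, c) :: s) t) =
  (x \in pts s t) && (y <= height k c s t x).
Proof.
apply/allpairsPdep/andP => [[x' [y' [hx hy [-> ->]]]]|[hx hy]].
  by rewrite mem_iota add0n ltnS in hy.
by exists x, y; rewrite mem_iota add0n ltnS.
Qed.

Lemma size_pts s t x : x \in pts s t -> size x = size s.
Proof.
elim: s x => [|[k c] s IH] x; first by rewrite inE => /eqP->.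
case: x => [|y x]; first by rewrite (negPf (mem_pts_nil _ _ _ _)).
by rewrite mem_pts_cons => /andP[/IH /= -> _].
Qed.

Lemma uniq_pts s t : uniq (pts s t).
Proof.
elim: s => [//|[k c] s IH].
apply: (@allpairs_uniq_dep _ (fun=> nat) _ (fun x y => y :: x)) => //.
  by move=> x _; apply: iota_uniq.
by move=> [x1 y1] [x2 y2] _ _ /= [-> ->].
Qed.

Hypothesis L_ge2 : 2 <= L.

(** A value of [mu] below [L * t] forces the newest coordinate below [t], while its axis has length
    [L * k * t >= 4 * t]; so the corners at the two ends do not meet. *)
Lemma nu_ge s t x : valid s -> 2 <= size s -> x \in pts s t ->
  mu x < L * t -> L * t <= nu s t x.
Proof.
case: s => [//|[k c] s] /= /and3P[k2 _ _] s1.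
case: x => [|y x]; first by rewrite (negPf (mem_pts_nil _ _ _ _)).
rewrite mem_pts_cons /= => /andP[/size_pts -> _].
have -> : weight (size s) = L by case: (s) s1.
move=> hmu; have yt : y < t.
  by rewrite -(ltn_pmul2l (ltnW L_ge2)) (leq_ltn_trans (leq_addr _ _) hmu).
apply: leq_trans (leq_addr _ _); rewrite leq_mul2l; apply/orP; right.
have : 4 * t <= L * k * t by rewrite leq_mul2r (@leq_mul 2 2) ?orbT.
lia.
Qed.

(** By [nu_ge] the bound [k * nu] is at least [L * k * t] here: the cut at the far corner does not
    reach the fibres over the near one. *)
Lemma height_full k c s t x : valid ((k, c) :: s) -> x \in pts s t ->
  mu x < L * t -> height k c s t x = L * k * t.
Proof.
rewrite /= /height => /and3P[k2 hc vs] xs hmu.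
case: c hc => //= s2; apply/minn_idPl.
by rewrite (mulnC L) -mulnA leq_mul2l nu_ge// orbT.
Qed.

Lemma sum_pts_cons k c s t (F : seq nat -> nat) :
  \sum_(x <- pts ((k, c) :: s) t) F x =
  \sum_(x <- pts s t) \sum_(y < (height k c s t x).+1) F (nat_of_ord y :: x).
Proof.
rewrite [LHS](@big_allpairs_dep _ _ _ _ (fun=> nat) _ (fun x y => y :: x)).
apply: eq_bigr => x _.
by rewrite -(big_mkord predT (fun y => F (y :: x))) /index_iota subn0.
Qed.

Lemma sum_trunc (F : nat -> nat) m n : m <= n ->
  (forall y, m < y -> F y = 0) -> \sum_(y < n.+1) F y = \sum_(y < m.+1) F y.
Proof.
move=> mn F0; rewrite -!(big_mkord predT F).
rewrite (@big_cat_nat _ _ _ m.+1 0) //= [X in _ + X]big1_seq ?addn0// => y.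
by rewrite mem_index_iota => /andP[_ /andP[/F0]].
Qed.

(* The sum of [L * u - mu x] (truncated) over all [x] in [nat ^ d]. *)
Fixpoint corner (d u : nat) : nat :=
  match d with
  | 0 => L * u
  | 1 => \sum_(y < (L * u).+1) (L * u - y)
  | d'.+1 => \sum_(y < u.+1) corner d' (u - y)
  end.

Lemma cornerS d u :
  0 < d -> corner d.+1 u = \sum_(y < u.+1) corner d (u - y).
Proof. by case: d. Qed.

(** No cut is felt near the origin, so the sum is the one over all of [nat ^ d], whatever [s] is.
    The scale [u] is separate from [t] because fixing the newest coordinate at [y] turns [u] into
    [u - y]. *)
Lemma corner_sum s t u : valid s -> 0 < size s -> u <= t ->
  \sum_(x <- pts s t) (L * u - mu x) = corner (size s) u.
Proof.
elim: s u => [//|[k c] s IH] u vs _ ut; rewrite sum_pts_cons.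
have /and3P[k2 hc vs'] := vs.
have Lu : L * u <= L * k * t.
  by rewrite -mulnA leq_mul2l (leq_trans ut) ?orbT// leq_pmull// ltnW.
case: s => [|p s'] in IH vs vs' hc *.
  rewrite /= big_seq1 /height; case: c hc {vs} => //= _.
  rewrite (@sum_trunc (fun y => L * u - (1 * y + 0)) (L * u)) //; last by lia.
  by apply: eq_bigr => y _; rewrite mul1n addn0.
set s := p :: s' in IH vs vs' hc *.
have Luy y x : L * u - (L * y + mu x) = L * (u - y) - mu x.
  by rewrite mulnBr subnDA.
rewrite [size _]/= cornerS//.
(* Terms with [u < y] vanish. If [mu x < L * u], the fibre over [x] is full and contains [0..u];
   otherwise both inner sums are zero. *)
transitivity (\sum_(x <- pts s t) \sum_(y < u.+1) (L * (u - y) - mu x)).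
  apply: eq_big_seq => x xs /=; rewrite (size_pts xs) /=.
  under eq_bigr do rewrite Luy.
  have [hmu|hmu] := ltnP (mu x) (L * u); last first.
    by rewrite !big1 => // y _; apply/eqP; rewrite subn_eq0 (leq_trans _ hmu)//
      leq_mul2l leq_subr orbT.
  rewrite (height_full vs xs); last by rewrite (leq_trans hmu)// leq_mul2l ut orbT.
  apply: (@sum_trunc (fun y => L * (u - y) - mu x)).
    apply: leq_trans Lu; rewrite leq_pmull//; lia.
  by move=> y uy; rewrite (eqP (ltnW uy : u - y == 0)) muln0.
rewrite exchange_big; apply: eq_bigr => y _.
by rewrite -(IH (u - y)) // (leq_trans (leq_subr _ _)).
Qed.

(** Reversing the newest coordinate exchanges [nu] and [mu]. This is possible over points with
    [mu x < L * t], where the fibre is full; over the others both summands vanish. *)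
Lemma far_corner_sum s t : valid s -> 2 <= size s ->
  \sum_(x <- pts s t) (L * t - nu s t x) = corner (size s) t.
Proof.
case: s => [//|[k c] s] vs s2.
rewrite -(@corner_sum _ t t vs) // ?(ltnW s2)// !sum_pts_cons.
apply: eq_big_seq => x xs /=; rewrite (size_pts xs).
have -> : weight (size s) = L by case: (s) s2.
have [hmu|hmu] := ltnP (mu x) (L * t); last first.
  by rewrite !big1 => // y _; apply/eqP; rewrite subn_eq0 (leq_trans hmu)//
    leq_addl.
rewrite (height_full vs xs hmu) (reindex_inj rev_ord_inj) /=.
apply: eq_bigr => y _; rewrite subSS subKn// -ltnS; exact: ltn_ord.
Qed.

(** The cut shortens the fibre over [x] by [k * (L * t - nu)], truncated at zero, and
    [far_corner_sum] adds up these losses. *)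
Lemma size_pts_cons k c s t : valid ((k, c) :: s) ->
  size (pts ((k, c) :: s) t) + (if c then k * corner (size s) t else 0)
  = (L * k * t).+1 * size (pts s t).
Proof.
move=> vs; have /and3P[k2 hc vs'] := vs.
rewrite -(sum1_size (pts s t)) -(sum1_size (pts (_ :: _) t)).
rewrite sum_pts_cons big_distrr /=.
under eq_bigr do rewrite sum_nat_const card_ord muln1.
case: c hc vs => /= [s2 vs|_ vs]; last first.
  by rewrite addn0; apply: eq_bigr => x _; rewrite muln1.
rewrite -far_corner_sum// big_distrr -big_split/=.
apply: eq_bigr => x _; rewrite muln1 addSn; congr _.+1.
rewrite /height (mulnC L) -mulnA -minnMr -mulnDr; congr (_ * _)%N; lia.
Qed.

End LatticePoints.

(** * Ehrhart polynomials and the signs of their coefficients *)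

Section EhrhartPolynomial.

Variables (R : realType) (L : nat).

(** Polynomial form of the multiset coefficient [C(t + k - 1, k)]. Summation over [0..u] just raises
    its index, which suits the recursion of [corner]. *)
Definition binp (k : nat) : {poly R} :=
  k`!%:R^-1 *: \prod_(i < k) ('X + i%:R%:P).

Lemma binpS k : binp k.+1 = k.+1%:R^-1 *: (binp k * ('X + k%:R%:P)).
Proof.
rewrite /binp big_ord_recr /= -scalerAl scalerA factS natrM invfM.
by congr (_ *: _); rewrite mulrC.
Qed.

Lemma binp0 : binp 0 = 1.
Proof. by rewrite /binp big_ord0 invr1 scale1r. Qed.

Lemma horner_binp k t : (binp k).[t%:R] = 'C((t + k).-1, k)%:R.
Proof.
elim: k => [|k IH]; first by rewrite binp0 hornerE bin0.
rewrite binpS hornerZ hornerM hornerD hornerX hornerC IH -natrD addnS /= mulrC -natrM.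
rewrite mulnC mul_bin_diag natrM mulrAC mulfV ?mul1r// pnatr_eq0//.
Qed.

(** Hockey-stick identity; [0 < k] makes the term at [y = 0] vanish. *)
Lemma sum_horner_binp k u : (0 < k)%N ->
  \sum_(y < u.+1) (binp k).[y%:R] = (binp k.+1).[u%:R].
Proof.
move=> k0; elim: u => [|u IH].
  by rewrite big_ord1 !horner_binp !bin_small // prednK.
rewrite big_ord_recr /= IH !horner_binp -natrD; congr _%:R.
by rewrite !addnS addSn /= binS addnC.
Qed.

Lemma size_binp k : (size (binp k) <= k.+1)%N.
Proof.
elim: k => [|k IH]; first by rewrite binp0 size_poly1.
rewrite binpS (leq_trans (size_scale_leq _ _))//.
rewrite (leq_trans (size_polyMleq _ _))// size_XaddC addn2 /=.
by rewrite ltnS.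
Qed.

Lemma coef0_binp k : (0 < k)%N -> (binp k)`_0 = 0.
Proof.
move=> k0; rewrite -horner_coef0 -[0]/(0%:R) horner_binp add0n.
by rewrite bin_small// prednK.
Qed.

Lemma coef1_binp k : (0 < k)%N -> (binp k)`_1 = k%:R^-1.
Proof.
case: k => // k _; elim: k => [|k IH].
  by rewrite binpS binp0 mul1r coefZ coefD coefX coefC addr0 mulr1.
rewrite binpS coefZ mulrDr coefD coefMX coefMC coef0_binp// IH /=.
by rewrite add0r mulVf ?mulr1// pnatr_eq0.
Qed.

(** The polynomial [G]. In dimension one [corner] is the triangular number [L u (L u + 1) / 2],
    which has these coefficients in [binp 2] and [binp 1]; each further coordinate raises both
    indices. *)
Definition cornerp (d : nat) : {poly R} :=
  L%:R ^+ 2 *: binp d.+1 + ((L%:R - L%:R ^+ 2) / 2) *: binp d.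

Lemma horner_cornerpE d x : (cornerp d).[x] =
  L%:R ^+ 2 * (binp d.+1).[x] + (L%:R - L%:R ^+ 2) / 2 * (binp d).[x].
Proof. by rewrite hornerD; congr (_ + _); apply: hornerZ. Qed.

Lemma sum_rev_ord n : ((\sum_(y < n.+1) (n - y)) * 2 = n * n.+1)%N.
Proof.
elim: n => [|n IH]; first by rewrite big_ord1.
rewrite big_ord_recl /= subn0 mulnDl.
under eq_bigr do rewrite subSS.
by rewrite IH; lia.
Qed.

Lemma horner_cornerp d u : (0 < d)%N ->
  (cornerp d).[u%:R] = (corner L d u)%:R.
Proof.
case: d => // d _; elim: d u => [|d IH] u.
  have /(congr1 (fun n => n%:R : R)) := sum_rev_ord (L * u).
  rewrite /corner natrM => E.
  have {E} -> : (\sum_(y < (L * u).+1) (L * u - y))%:R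
      = (L * u * (L * u).+1)%:R / 2 :> R by rewrite -E mulfK// pnatr_eq0.
  rewrite /cornerp !binpS binp0 !(hornerD, hornerZ, hornerM, hornerX, hornerC) -[in RHS]addn1 !(natrM, natrD).
  by field.
rewrite cornerS// natr_sum (reindex_inj rev_ord_inj) /=.
under eq_bigr => y _ do rewrite subSS (subKn (leq_ord y)) -IH horner_cornerpE.
by rewrite big_split /= -!mulr_sumr !sum_horner_binp// horner_cornerpE.
Qed.

Lemma coef_cornerp d j : (cornerp d)`_j =
  L%:R ^+ 2 * (binp d.+1)`_j + (L%:R - L%:R ^+ 2) / 2 * (binp d)`_j.
Proof. by rewrite coefD; congr (_ + _); apply: coefZ. Qed.

Lemma coef0_cornerp d : (0 < d)%N -> (cornerp d)`_0 = 0.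
Proof.
by move=> d0; rewrite coef_cornerp !coef0_binp// !mulr0 addr0.
Qed.

Lemma coef1_cornerp d : (0 < d)%N ->
  (cornerp d)`_1 = L%:R ^+ 2 / d.+1%:R + (L%:R - L%:R ^+ 2) / 2 / d%:R.
Proof. by move=> d0; rewrite coef_cornerp !coef1_binp. Qed.

Lemma size_cornerp d : (size (cornerp d) <= d.+2)%N.
Proof.
rewrite (leq_trans (size_polyD _ _))// geq_max; apply/andP; split.
  exact: leq_trans (size_scale_leq _ _) (size_binp _).
exact: leq_trans (leq_trans (size_scale_leq _ _) (size_binp _)) (leqnSn _).
Qed.

(** The recursion of [size_pts_cons], read as one between polynomials. *)
Fixpoint ehr (s : seq (nat * bool)) : {poly R} :=
  if s is (k, c) :: s' then
    ehr s' * (1 + (L * k)%:R *: 'X)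
      - (if c then k%:R *: cornerp (size s') else 0)
  else 1.

Lemma coef0_ehr s : valid s -> (ehr s)`_0 = 1.
Proof.
elim: s => [|[k c] s IH] /=; first by rewrite coef1.
move=> /and3P[_ hc /IH e1].
rewrite mulrDr mulr1 -scalerAr coefB coefD coefZ coefMX mulr0 addr0 e1.
by case: c hc => /= s2; rewrite ?coefZ ?coef0_cornerp ?coef0 ?mulr0 ?subr0// ltnW.
Qed.

Lemma coefS_ehr k c s j : (ehr ((k, c) :: s))`_j.+1 =
  (ehr s)`_j.+1 +
  k%:R * (L%:R * (ehr s)`_j - (if c then (cornerp (size s))`_j.+1 else 0)).
Proof.
rewrite /= mulrDr mulr1 -scalerAr coefB coefD coefZ coefMX /= natrM.
by case: c; rewrite ?coefZ ?coef0; ring.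
Qed.

Lemma size_ehr s : (size (ehr s) <= (size s).+1)%N.
Proof.
elim: s => [|[k c] s IH] /=; first by rewrite size_poly1.
rewrite (leq_trans (size_polyD _ _))// geq_max size_polyN; apply/andP; split.
  rewrite (leq_trans (size_polyMleq _ _))//.
  have : (size (1 + (L * k)%:R *: 'X : {poly R})%R <= 2)%N.
    rewrite (leq_trans (size_polyD _ _))// geq_max size_poly1.
    by rewrite (leq_trans (size_scale_leq _ _)) ?size_polyX.
  by move: IH; lia.
case: c; last by rewrite size_poly0.
by rewrite (leq_trans (size_scale_leq _ _)) ?size_cornerp.
Qed.

Lemma exists_large_multiple n (a b : nat -> R) :
  (forall j, (j < n)%N -> 0 < b j) ->
  exists2 k, (2 <= k)%N & forall j, (j < n)%N -> a j < k%:R * b j.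
Proof.
elim: n => [|n IH] b0; first by exists 2.
have [k k2 hk] := IH (fun j jn => b0 j (ltnW jn)).
pose m := Num.bound (`|a n| / b n).
exists (maxn k m); first by rewrite leq_max k2.
have bn := b0 n (ltnSn n).
move=> j; rewrite ltnS leq_eqVlt => /orP[/eqP ->|jn]; last first.
  rewrite (lt_le_trans (hk j jn))// ler_wpM2r ?ler_nat ?leq_maxl//.
  by rewrite ltW// b0 // ltnW.
rewrite -ltr_pdivrMr//; apply: (@lt_le_trans _ _ m%:R); last first.
  by rewrite ler_nat leq_maxr.
apply: le_lt_trans (archi_boundP _); last by rewrite divr_ge0// ltW.
by rewrite ler_wpM2r ?ler_norm// invr_ge0 ltW.
Qed.

Hypothesis L_ge2 : (2 <= L)%N.

Lemma horner_ehr s t : valid s -> (ehr s).[t%:R] = (size (pts L s t))%:R.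
Proof.
elim: s => [|[k c] s IH] vs; first by rewrite /= hornerE.
have /and3P[k2 hc vs'] := vs.
have /(congr1 (fun n => n%:R : R)) := size_pts_cons L_ge2 t vs.
rewrite natrD natrM => /(canRL (addrK _)) ->.
rewrite [ehr _]/= hornerD hornerN hornerM IH// mulrC.
have -> : (1 + (L * k)%:R *: 'X : {poly R}).[t%:R] = (L * k * t).+1%:R.
  by rewrite !hornerE -natr1 !natrM addrC.
congr (_ - _); case: c hc {vs} => /= s2; last by rewrite horner0.
by rewrite hornerZ horner_cornerp ?natrM// ltnW.
Qed.

(** Asking the coefficients to exceed [M], and not only [0], in absolute value makes the induction
    work: [L] times an old coefficient then outweighs any coefficient of [cornerp]. *)
Lemma exists_ehr_signs (D : nat) (M : R) : 0 <= M ->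
  (forall d, (2 <= d <= D)%N -> L%:R < (cornerp d)`_1) ->
  (forall d j, (d <= D)%N -> `|(cornerp d)`_j| <= M) ->
  forall d (neg : pred nat), (2 <= d <= D)%N ->
  (forall j, neg j -> (1 <= j <= d - 2)%N) ->
  exists s, [/\ size s = d, valid s &
    forall j, (1 <= j <= d)%N -> M < (-1) ^+ neg j * (ehr s)`_j].
Proof.
move=> M0 hL hM; elim=> [//|d IH] neg hd hneg.
have L0 : 0 < L%:R :> R by rewrite ltr0n ltnW.
case: (ltnP d 2) => d2.
  (* Base case in dimension two: no index may be negative, and a square of side [L * k] suffices. *)
  have -> : d = 1%N by lia.
  have neg0 j : neg j = false.
    by apply/negP => /hneg; lia.
  pose k := (Num.bound M).+2.
  have kM : M < k%:R.
    by rewrite (lt_le_trans (archi_boundP M0))// ler_nat ltnW.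
  have L1 : 1 <= L%:R :> R by rewrite ler1n ltnW.
  exists [:: (k, false); (k, false)]; split => // j j12.
  have e0 : ehr [::] = 1 by [].
  have k1 : 1 <= k%:R :> R by rewrite ler1n.
  have Lk : k%:R <= L%:R * k%:R :> R by nra.
  have [->|->] : j = 1%N \/ j = 2%N by lia.
    rewrite neg0 expr0 mul1r !coefS_ehr !coef0_ehr// e0 coef1 /=; lra.
  rewrite neg0 expr0 mul1r !coefS_ehr !coef0_ehr// e0 !coef1 /=; nra.
have dD : (2 <= d <= D)%N by lia.
(* The old sign pattern is the required one moved down by one place. Index [0] is left out of it,
   since the new coefficient of [t] is governed by the cut. *)
have [s [ss vs hs]] : exists s, [/\ size s = d, valid s &
    forall j, (1 <= j <= d)%N -> M < (-1) ^+ neg j.+1 * (ehr s)`_j].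
  have [||s [ss vs hs]] := IH (fun j => (0 < j)%N && neg j.+1) => //.
    by move=> j /andP[j0 /hneg]; lia.
  exists s; split => // j /[dup] /andP[j0 _] /hs; by rewrite j0.
(* By [coefS_ehr], [f j] is the factor of [k] in the new coefficient of [t^(j+1)]. It has the wanted
   sign, so a large [k] overcomes the old coefficient. *)
pose f j := L%:R * (ehr s)`_j - (if neg 1%N then (cornerp d)`_j.+1 else 0).
have f0 j : (j < d.+1)%N -> 0 < (-1) ^+ neg j.+1 * f j.
  rewrite /f; case: j => [|j] jd.
    rewrite coef0_ehr// mulr1; case: (neg 1%N); last by rewrite expr0; lra.
    by rewrite expr1; have := hL d dD; lra.
  have := hs j.+1 jd; set x := (ehr s)`_j.+1; set y := (cornerp d)`_j.+2.
  have : `|y| <= M by apply: hM; lia.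
  rewrite ler_norml => /andP[y1 y2] Mx.
  have L1 : 1 <= L%:R :> R by rewrite ler1n ltnW.
  have : M < L%:R * ((-1) ^+ neg j.+2 * x) by rewrite (lt_le_trans Mx)// ler_peMl// (le_trans M0)// ltW.
  by case: (neg 1%N) (neg j.+2) {Mx} => [] [] /=; rewrite ?expr0 ?expr1; lra.
have [k k2 hk] := exists_large_multiple
  (fun j => M - (-1) ^+ neg j.+1 * (ehr s)`_j.+1) f0.
exists ((k, neg 1%N) :: s); split => [/=|/=|].
- by rewrite ss.
- by rewrite k2 vs ss d2 implybT.
case=> // j /andP[_ jd]; have := hk j jd.
by rewrite ltrBlDl mulrCA -mulrDr coefS_ehr ss.
Qed.

End EhrhartPolynomial.

(** * Row vectors, convex hulls and affine maps *)

Section Coordinates.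

Variable R : realType.

Definition hd d (x : 'rV[R]_d.+1) : R := x ord0 ord0.
Definition tl d (x : 'rV[R]_d.+1) : 'rV[R]_d := \row_i x ord0 (lift ord0 i).
Definition cons_row d (y : R) (x : 'rV[R]_d) : 'rV[R]_d.+1 :=
  \row_i (if unlift ord0 i is Some j then x ord0 j else y).

Lemma hd_cons d y (x : 'rV[R]_d) : hd (cons_row y x) = y.
Proof. by rewrite /hd mxE unlift_none. Qed.

Lemma tl_cons d y (x : 'rV[R]_d) : tl (cons_row y x) = x.
Proof. by apply/rowP => i; rewrite !mxE liftK. Qed.

Lemma hd_tl_inj d (x z : 'rV[R]_d.+1) : hd x = hd z -> tl x = tl z -> x = z.
Proof.
move=> h /rowP t; apply/rowP => i.
by case: (unliftP ord0 i) => [j ->|->//]; have := t j; rewrite !mxE.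
Qed.

Lemma hdD d (x z : 'rV[R]_d.+1) : hd (x + z) = hd x + hd z.
Proof. by rewrite /hd mxE. Qed.

Lemma hdZ d a (x : 'rV[R]_d.+1) : hd (a *: x) = a * hd x.
Proof. by rewrite /hd mxE. Qed.

Lemma tlZ d a (x : 'rV[R]_d.+1) : tl (a *: x) = a *: tl x.
Proof. by apply/rowP => i; rewrite !mxE. Qed.

Lemma hd_sum d n (a : 'I_n -> R) (v : 'I_n -> 'rV[R]_d.+1) :
  hd (\sum_i a i *: v i) = \sum_i a i * hd (v i).
Proof. by rewrite /hd summxE; apply: eq_bigr => i _; rewrite mxE. Qed.

Lemma tl_sum d n (a : 'I_n -> R) (v : 'I_n -> 'rV[R]_d.+1) :
  tl (\sum_i a i *: v i) = \sum_i a i *: tl (v i).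
Proof.
apply/rowP => j; rewrite mxE !summxE.
by apply: eq_bigr => i _; rewrite !mxE.
Qed.

Definition nonneg d (x : 'rV[R]_d) := forall i, 0 <= x ord0 i.

Lemma nonneg_tl d (x : 'rV[R]_d.+1) : nonneg x -> nonneg (tl x).
Proof. by move=> x0 i; rewrite mxE. Qed.

Lemma nonnegE d (x : 'rV[R]_d.+1) : 0 <= hd x -> nonneg (tl x) -> nonneg x.
Proof.
move=> h t i; case: (unliftP ord0 i) => [j ->|->//].
by have := t j; rewrite mxE.
Qed.

Lemma lattice_tl d (x : 'rV[R]_d.+1) :
  @integer_lattice R _ x -> @integer_lattice R _ (tl x).
Proof. by move=> xZ i; rewrite mxE. Qed.

Lemma latticeE d (x : 'rV[R]_d.+1) : hd x \is a Num.int ->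
  @integer_lattice R _ (tl x) -> @integer_lattice R _ x.
Proof.
move=> h t i; case: (unliftP ord0 i) => [j ->|->//].
by have := t j; rewrite mxE.
Qed.

Definition affine_fun d (f : 'rV[R]_d -> R) :=
  forall n (a : 'I_n -> R) v, \sum_i a i = 1 ->
  f (\sum_i a i *: v i) = \sum_i a i * f (v i).

Lemma sub_convex_hull d (A B : set 'rV[R]_d) :
  A `<=` B -> convex_hull A `<=` convex_hull B.
Proof.
move=> AB x [n [v [a [Av a0 a1 ->]]]]; exists n, v, a; split => // i.
exact: AB.
Qed.

Lemma convex_hull_conv d (A : set 'rV[R]_d) x y (c : R) : 0 <= c <= 1 ->
  convex_hull A x -> convex_hull A y -> convex_hull A ((1 - c) *: x + c *: y).
Proof.
move=> /andP[c0 c1] [m [v [a [Av a0 a1 ->]]]] [n [w [b [Aw b0 b1 ->]]]].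
exists (m + n)%N, (fun i => match fintype.split i with inl j => v j | inr j => w j end).
exists (fun i => match fintype.split i with inl j => (1 - c) * a j | inr j => c * b j end).
split=> [i|i||].
- by case: fintype.split.
- by case: fintype.split => j; apply: mulr_ge0 => //; rewrite subr_ge0.
- rewrite big_split_ord /=.
  under eq_bigr do rewrite (unsplitK (inl _)).
  under [X in _ + X]eq_bigr do rewrite (unsplitK (inr _)).
  by rewrite -!mulr_sumr a1 b1 !mulr1 subrK.
- rewrite big_split_ord /= !scaler_sumr; congr (_ + _); apply: eq_bigr => i _.
    by rewrite (unsplitK (inl _)) scalerA.
  by rewrite (unsplitK (inr _)) scalerA.
Qed.

Lemma affine_simplex d (A : set 'rV[R]_d) n p (u : 'I_n -> 'rV[R]_d)
    (w : 'I_n -> R) :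
  A p -> (forall i, A (p + u i)) -> affine_hull A (p + \sum_i w i *: u i).
Proof.
move=> Ap Au; pose v i := if unlift ord0 i is Some j then p + u j else p.
pose a i := if unlift ord0 i is Some j then w j else 1 - \sum_j w j.
exists n.+1, v, a; rewrite !big_ord_recl /v /a unlift_none.
split=> [i||].
- by case: unlift.
- by under [X in _ + X]eq_bigr do rewrite liftK; rewrite subrK.
- under [X in _ = _ + X]eq_bigr do rewrite liftK scalerDr.
  by rewrite big_split /= -scaler_suml addrA -scalerDl subrK scale1r.
Qed.

Lemma convex_simplex d (A : set 'rV[R]_d) n p (u : 'I_n -> 'rV[R]_d)
    (w : 'I_n -> R) :
  A p -> (forall i, A (p + u i)) -> (forall i, 0 <= w i) -> \sum_i w i <= 1 ->
  convex_hull A (p + \sum_i w i *: u i).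
Proof.
move=> Ap Au w0 w1; pose v i := if unlift ord0 i is Some j then p + u j else p.
pose a i := if unlift ord0 i is Some j then w j else 1 - \sum_j w j.
exists n.+1, v, a; rewrite !big_ord_recl /v /a unlift_none.
split=> [i|i||].
- by case: unlift.
- by case: unlift => //; rewrite subr_ge0.
- by under [X in _ + X]eq_bigr do rewrite liftK; rewrite subrK.
- under [X in _ = _ + X]eq_bigr do rewrite liftK scalerDr.
  by rewrite big_split /= -scaler_suml addrA -scalerDl subrK scale1r.
Qed.

(** As [lo] and [hi] are affine, the combination that gives [tl x] also gives the points of both
    graphs above it; [x] lies on the segment between these. *)
Lemma convex_hull_fiber d (B : set 'rV[R]_d) (A : set 'rV[R]_d.+1)
    (lo hi : 'rV[R]_d -> R) x :
  affine_fun lo -> affine_fun hi ->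
  (forall v, B v -> A (cons_row (lo v) v) /\ A (cons_row (hi v) v)) ->
  convex_hull B (tl x) -> lo (tl x) <= hd x <= hi (tl x) -> convex_hull A x.
Proof.
move=> aflo afhi BA Bx /andP[lox xhi].
have lift (f : 'rV[R]_d -> R) : affine_fun f ->
    (forall v, B v -> A (cons_row (f v) v)) ->
    convex_hull A (cons_row (f (tl x)) (tl x)).
  move=> aff Af; case: Bx => n [v [a [Bv a0 a1 E]]].
  exists n, (fun i => cons_row (f (v i)) (v i)), a; split => // [i|].
    exact: Af.
  apply: hd_tl_inj; rewrite ?hd_sum ?tl_sum ?hd_cons ?tl_cons.
    by rewrite E aff//; apply: eq_bigr => i _; rewrite hd_cons.
  by rewrite E; apply: eq_bigr => i _; rewrite tl_cons.
have Alo := lift lo aflo (fun v Bv => (BA v Bv).1).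
have Ahi := lift hi afhi (fun v Bv => (BA v Bv).2).
(* A segment of length zero is set apart, because [c] divides by the length. *)
move: (le_trans lox xhi); rewrite le_eqVlt => /orP[/eqP lh|lh].
  suff -> : x = cons_row (lo (tl x)) (tl x) by [].
  apply: hd_tl_inj; rewrite ?hd_cons ?tl_cons//.
  by apply: le_anti; rewrite lox lh xhi.
pose c := (hd x - lo (tl x)) / (hi (tl x) - lo (tl x)).
have h0 : 0 < hi (tl x) - lo (tl x) by rewrite subr_gt0.
have c01 : 0 <= c <= 1.
  rewrite /c divr_ge0 ?subr_ge0 ?(ltW lh)//= ler_pdivrMr// mul1r.
  by rewrite lerD2r.
suff -> : x = (1 - c) *: cons_row (lo (tl x)) (tl x)
              + c *: cons_row (hi (tl x)) (tl x).
  exact: convex_hull_conv.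
apply: hd_tl_inj.
  by rewrite hdD !hdZ !hd_cons /c; field; rewrite gt_eqF.
apply/rowP => i; rewrite !mxE liftK; rewrite mxE; ring.
Qed.

Lemma convex_hull_map d e (A : set 'rV[R]_d) (B : set 'rV[R]_e)
    (f : 'rV[R]_d -> 'rV[R]_e) x :
  (forall n (a : 'I_n -> R) v, \sum_i a i = 1 ->
    f (\sum_i a i *: v i) = \sum_i a i *: f (v i)) ->
  (forall v, A v -> B (f v)) -> convex_hull A x -> convex_hull B (f x).
Proof.
move=> aff AB [n [v [a [Av a0 a1 ->]]]].
exists n, (fun i => f (v i)), a; split => // [i|]; first exact: AB.
exact: aff.
Qed.

Definition reflect_hd d (c : R) (x : 'rV[R]_d.+1) := cons_row (c - hd x) (tl x).

Lemma reflect_hdK d c (x : 'rV[R]_d.+1) : reflect_hd c (reflect_hd c x) = x.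
Proof.
apply: hd_tl_inj; rewrite ?hd_cons ?tl_cons//.
by rewrite opprB addrC subrK.
Qed.

Lemma reflect_hd_affine d c n (a : 'I_n -> R) (v : 'I_n -> 'rV[R]_d.+1) :
  \sum_i a i = 1 ->
  reflect_hd c (\sum_i a i *: v i) = \sum_i a i *: reflect_hd c (v i).
Proof.
move=> a1; apply: hd_tl_inj; rewrite ?hd_sum ?tl_sum ?hd_cons ?tl_cons.
  rewrite hd_sum -[c in LHS]mul1r -a1 mulr_suml -sumrB.
  by apply: eq_bigr => i _; rewrite hd_cons mulrBr.
by rewrite tl_sum; apply: eq_bigr => i _; rewrite tl_cons.
Qed.

End Coordinates.

(** * The real polytope and its lattice points *)

Section Polytope.

Variables (R : realType) (L : nat).

(* The edge of the corner [mu x <= L] along the axis of weight [weight L d] has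
   this lattice length. *)
Definition step (d : nat) : nat := if d is 0 then L else 1%N.

Lemma weight_step d : (weight L d)%:R * (step d)%:R = L%:R :> R.
Proof. by case: d => [|d] /=; rewrite ?mul1r ?mulr1. Qed.

(** Real counterpart of [mu]: among [d] coordinates, the one of index [i] has [d - i.+1] older
    ones. *)
Definition mur d (x : 'rV[R]_d) : R :=
  \sum_(i < d) (weight L (d - i.+1))%:R * x ord0 i.

Lemma murS d (x : 'rV[R]_d.+1) :
  mur x = (weight L d)%:R * hd x + mur (tl x).
Proof.
rewrite /mur big_ord_recl subSS subn0; congr (_ + _).
by apply: eq_bigr => i _; rewrite mxE lift0 subSS.
Qed.

Lemma mur0 (x : 'rV[R]_0) : mur x = 0.
Proof. by rewrite /mur big_ord0. Qed.

Lemma mur_zero d : mur (0 : 'rV[R]_d) = 0.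
Proof. by rewrite /mur big1// => i _; rewrite mxE mulr0. Qed.

Lemma murZ d a (x : 'rV[R]_d) : mur (a *: x) = a * mur x.
Proof. by rewrite /mur mulr_sumr; apply: eq_bigr => i _; rewrite mxE mulrCA. Qed.

Lemma mur_ge0 d (x : 'rV[R]_d) : nonneg x -> 0 <= mur x.
Proof. by move=> x0; apply: sumr_ge0 => i _; rewrite mulr_ge0. Qed.

Lemma mur_sum d n (a : 'I_n -> R) (v : 'I_n -> 'rV[R]_d) :
  mur (\sum_i a i *: v i) = \sum_i a i * mur (v i).
Proof.
rewrite /mur; under eq_bigr do rewrite summxE mulr_sumr.
rewrite exchange_big /=; apply: eq_bigr => i _; rewrite mulr_sumr.
by apply: eq_bigr => j _; rewrite mxE mulrCA.
Qed.

Lemma mur_delta d (i : 'I_d) :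
  mur (delta_mx ord0 i) = (weight L (d - i.+1))%:R.
Proof.
rewrite /mur (bigD1 i) //= mxE !eqxx mulr1 big1 ?addr0// => j ji.
by rewrite mxE (negPf ji) mulr0.
Qed.

Definition nur (s : seq (nat * bool)) (t : R) : 'rV[R]_(size s) -> R :=
  match s return 'rV[R]_(size s) -> R with
  | (k, _) :: s' => fun x =>
      (weight L (size s'))%:R * ((L * k)%:R * t - hd x) + mur (tl x)
  | [::] => fun=> 0
  end.

(** The inequalities are homogeneous in [t] and [x] together, so the parameter [t] yields the
    dilates of [polytope s 1]. *)
Fixpoint polytope (s : seq (nat * bool)) (t : R) : set 'rV[R]_(size s) :=
  match s return set 'rV[R]_(size s) with
  | (k, c) :: s' => fun x : 'rV[R]_(size s').+1 =>
      [/\ polytope t (tl x), 0 <= hd x <= (L * k)%:R * t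
        & c -> hd x <= k%:R * nur t (tl x)]
  | [::] => setT
  end.

Lemma nurZ s a t (x : 'rV[R]_(size s)) :
  nur (a * t) (a *: x) = a * nur t x.
Proof.
case: s x => [|[k c] s] x /=; first by rewrite mulr0.
by rewrite hdZ tlZ murZ; ring.
Qed.

Lemma nur_affine s t : affine_fun (@nur s t).
Proof.
move=> n a v a1; case: s v => [|[k c] s] v /=.
  by rewrite big1 // => i _; rewrite mulr0.
under [RHS]eq_bigr do rewrite mulrDr mulrCA mulrBr.
rewrite big_split /= -mulr_sumr sumrB -mulr_suml a1 mul1r.
by rewrite hd_sum tl_sum mur_sum.
Qed.

Lemma polytopeZ s a t (x : 'rV[R]_(size s)) : 0 < a ->
  polytope t x -> polytope (a * t) (a *: x).
Proof.
move=> a0; elim: s x => [|[k c] s IH] //= x [/IH xs /andP[h0 h1] hc].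
rewrite tlZ hdZ nurZ; split => // [|/hc].
  by rewrite mulr_ge0 ?(ltW a0)//= mulrCA ler_pM2l.
by rewrite mulrCA ler_pM2l.
Qed.

Lemma dilate_polytope s t : (0 < t)%N ->
  dilate t (@polytope s 1) = @polytope s t%:R.
Proof.
move=> t0; have tR : 0 < t%:R :> R by rewrite ltr0n.
apply/seteqP; split => [_ [x xs <-]|x xs].
  by have := polytopeZ tR xs; rewrite mulr1.
exists (t%:R^-1 *: x); last by rewrite scalerA mulfV ?scale1r// gt_eqF.
have ti : 0 < t%:R^-1 :> R by rewrite invr_gt0.
by have := polytopeZ ti xs; rewrite mulVf ?gt_eqF.
Qed.

Lemma polytope_nonneg s t (x : 'rV[R]_(size s)) : polytope t x -> nonneg x.
Proof.
elim: s x => [|[k c] s IH] /= x; first by move=> _ [].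
by move=> [/IH ts /andP[h0 _] _]; apply: nonnegE.
Qed.

Lemma polytope_convex s t n (a : 'I_n -> R) (v : 'I_n -> 'rV[R]_(size s)) :
  (forall i, 0 <= a i) -> \sum_i a i = 1 ->
  (forall i, polytope t (v i)) -> polytope t (\sum_i a i *: v i).
Proof.
move=> a0 a1; elim: s v => [//|[k c] s IH] v hv.
rewrite /= hd_sum tl_sum; split.
- by apply: IH => i; have [] := hv i.
- apply/andP; split.
    by apply: sumr_ge0 => i _; have [_ /andP[h0 _] _] := hv i; rewrite mulr_ge0.
  have -> : (L * k)%:R * t = \sum_i a i * ((L * k)%:R * t).
    by rewrite -mulr_suml a1 mul1r.
  apply: ler_sum => i _.
  by have [_ /andP[_ h1] _] := hv i; apply: ler_wpM2l.
- move=> cT; rewrite nur_affine// mulr_sumr; apply: ler_sum => i _.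
  by rewrite mulrCA; have [_ _ /(_ cT) h1] := hv i; apply: ler_wpM2l.
Qed.

Definition row_of_seq d (z : seq nat) : 'rV[R]_d := \row_i (nth 0%N z i)%:R.

Lemma hd_row_of_seq d y z : hd (row_of_seq d.+1 (y :: z)) = y%:R.
Proof. by rewrite /hd mxE. Qed.

Lemma tl_row_of_seq d y z : tl (row_of_seq d.+1 (y :: z)) = row_of_seq d z.
Proof. by apply/rowP => i; rewrite !mxE lift0. Qed.

Lemma mur_row_of_seq d z : size z = d ->
  mur (row_of_seq d z) = (mu L z)%:R.
Proof.
move=> <-; elim: z => [|y z IH] /=; first by rewrite mur0.
by rewrite murS hd_row_of_seq tl_row_of_seq IH natrD natrM.
Qed.

Lemma nur_row_of_seq s t z : z \in pts L s t ->
  nur t%:R (row_of_seq (size s) z) = (nu L s t z)%:R.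
Proof.
case: s => [//|[k c] s] zs.
case: z zs => [|y z]; first by rewrite (negPf (mem_pts_nil _ _ _ _ _)).
rewrite mem_pts_cons => /andP[zs yh] /=.
rewrite hd_row_of_seq tl_row_of_seq (mur_row_of_seq (size_pts zs)).
rewrite (size_pts zs).
have yL : (y <= L * k * t)%N.
  by rewrite (leq_trans yh)// /height; case: (c); rewrite ?geq_minl.
by rewrite natrD !natrM natrB// !natrM.
Qed.

Lemma lattice_polytope s t (x : 'rV[R]_(size s)) :
  (polytope t%:R x /\ @integer_lattice R _ x) <->
  exists2 z, z \in pts L s t & x = row_of_seq (size s) z.
Proof.
elim: s x => [|[k c] s IH] x.
  split => [_|_]; last by split => // -[].
  by exists [::] => //; apply/rowP => -[].
split=> [[[xs /andP[h0 h1] hc] xZ]|[z zs ->]].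
  have [z zs E] : exists2 z, z \in pts L s t & tl x = row_of_seq (size s) z.
    by apply/IH; split => //; apply: lattice_tl.
  have /natrP[y Ey] : hd x \is a Num.nat by rewrite natrEint h0 andbT; apply: xZ.
  exists (y :: z); last first.
    by apply: hd_tl_inj; rewrite ?hd_row_of_seq ?tl_row_of_seq.
  rewrite mem_pts_cons zs /=; move: h1 hc.
  rewrite E nur_row_of_seq// Ey -!natrM !ler_nat /height => h1.
  by case: (c) => // /(_ isT); rewrite leq_min h1.
case: z zs => [|y z]; first by rewrite (negPf (mem_pts_nil _ _ _ _ _)).
rewrite mem_pts_cons => /andP[zs yh].
have /IH[ps pZ] : exists2 z', z' \in pts L s t
  & row_of_seq (size s) z = row_of_seq (size s) z' by exists z.
have yL : (y <= L * k * t)%N.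
  by rewrite (leq_trans yh)// /height; case: (c); rewrite ?geq_minl.
split; last first.
  by apply: latticeE; rewrite ?hd_row_of_seq ?tl_row_of_seq ?natr_int.
rewrite /= hd_row_of_seq tl_row_of_seq nur_row_of_seq//; split=> //.
  by rewrite ler0n -natrM ler_nat.
move=> cT; rewrite -natrM ler_nat.
by move: yh; rewrite /height cT leq_min => /andP[].
Qed.

Lemma row_of_seq_inj d y z : size y = d -> size z = d ->
  row_of_seq d y = row_of_seq d z -> y = z.
Proof.
move=> yd zd /rowP E; apply: (@eq_from_nth _ 0%N) => [|i]; first by rewrite yd zd.
rewrite yd => id; have := E (Ordinal id); rewrite !mxE => /eqP.
by rewrite eqr_nat => /eqP.
Qed.

Lemma card_lattice_polytope s t :
  @polytope s t%:R `&` @integer_lattice R _ #= `I_(size (pts L s t)).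
Proof.
pose f i := row_of_seq (size s) (nth [::] (pts L s t) i).
have -> : @polytope s t%:R `&` @integer_lattice R _
    = f @` `I_(size (pts L s t)).
  apply/seteqP; split => [x /lattice_polytope [z zs ->]|_ [i it <-]].
    by exists (index z (pts L s t)); rewrite /f/= ?index_mem ?nth_index.
  by apply/lattice_polytope; exists (nth [::] (pts L s t) i); rewrite ?mem_nth.
apply: inj_card_eq => i j; rewrite !inE /= => it jt.
move=> /row_of_seq_inj E; apply/eqP.
rewrite -(nth_uniq [::] it jt (uniq_pts _ _ _)); apply/eqP.
by apply: E; apply: size_pts; apply: mem_nth.
Qed.

End Polytope.

(** * The polytope is integral and full-dimensional *)

Section Integrality.

Variables (R : realType) (L : nat).
Hypothesis L_ge2 : (2 <= L)%N.

Lemma natr_ge2 : 2 <= L%:R :> R.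
Proof. by rewrite ler_nat. Qed.

Local Notation mur := (@mur R L _).
Local Notation nur s := (@nur R L s 1).
Local Notation polytope s := (@polytope R L s 1).

Lemma weight_ge1 d : 1 <= (weight L d)%:R :> R.
Proof. by rewrite ler1n; case: d => //= _; rewrite ltnW. Qed.

Lemma weight_le d : (weight L d)%:R <= L%:R :> R.
Proof. by rewrite ler_nat; case: d => //=; rewrite ltnW. Qed.

Lemma step_gt0 d : 0 < (step L d)%:R :> R.
Proof. by rewrite ltr0n; case: d => //=; exact: ltnW. Qed.

Lemma height_ge2 k : (2 <= k)%N -> 2 * L%:R <= (L * k)%:R :> R.
Proof. by move=> k2; rewrite -natrM ler_nat mulnC leq_mul2l k2 orbT. Qed.

Lemma weight_height_ge d k : (2 <= k)%N ->
  2 * L%:R <= (weight L d)%:R * (L * k)%:R :> R.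
Proof.
move=> /height_ge2 k2; apply: (le_trans k2).
by rewrite ler_peMl// weight_ge1.
Qed.

Lemma nur_ge_near0 s (x : 'rV[R]_(size s)) : valid s -> (0 < size s)%N ->
  nonneg x -> mur x <= L%:R -> L%:R <= nur s x.
Proof.
case: s x => [//|[k c] s] x /= /and3P[k2 _ _] _ x0.
have m0 := mur_ge0 L (nonneg_tl x0); have h0 : 0 <= hd x := x0 ord0.
by have := weight_height_ge (size s) k2; rewrite murS mulr1; lra.
Qed.

(** On the near corner the newest coordinate is at most [L], whereas both its axis and, by
    [nur_ge_near0], the bound of the cut are at least [2 * L]. *)
Lemma polytope_near0 s (x : 'rV[R]_(size s)) : valid s -> nonneg x ->
  mur x <= L%:R -> polytope s x.
Proof.
have LR := natr_ge2.
elim: s x => [//|[k c] s IH] x /= /and3P[k2 hc vs] x0.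
have t0 := nonneg_tl x0; have h0 : 0 <= hd x := x0 ord0.
have m0 := mur_ge0 L t0.
have w1 := weight_ge1 (size s).
rewrite murS => hx; have hL : hd x <= L%:R by nra.
have k2L := height_ge2 k2.
split; first by apply: IH => //; nra.
  by rewrite h0 mulr1; lra.
move=> cT; rewrite cT /= in hc.
have : L%:R <= nur s (tl x) by apply: nur_ge_near0 => //; [exact: ltnW|nra].
have : 2 <= k%:R :> R by rewrite ler_nat.
nra.
Qed.

(** On the far corner [tl x] lies in the near corner of the older coordinates, above which the fibre
    is full. *)
Lemma polytope_far k c s (x : 'rV[R]_(size s).+1) : valid ((k, c) :: s) ->
  nonneg (tl x) -> hd x <= (L * k)%:R -> nur ((k, c) :: s) x <= L%:R ->
  polytope ((k, c) :: s) x.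
Proof.
have LR := natr_ge2.
move=> /= /and3P[k2 hc vs] t0 hk; rewrite mulr1 => hx.
have m0 := mur_ge0 L t0.
have w1 := weight_ge1 (size s); have k2L := height_ge2 k2.
have mL : mur (tl x) <= L%:R by nra.
split; first exact: polytope_near0.
  by apply/andP; split; nra.
move=> cT; rewrite cT /= in hc.
have := nur_ge_near0 vs (ltnW hc) t0 mL.
rewrite natrM in hk; have : 2 <= k%:R :> R by rewrite ler_nat.
nra.
Qed.

Definition near_vertex d : set 'rV[R]_d :=
  [set v | [/\ @integer_lattice R _ v, nonneg v & mur v = 0 \/ mur v = L%:R]].

(** The vertices are the origin and [step] times the unit vectors. Since [L / step = weight], the
    bound [mur x <= L] says that the weights [x_i / step] sum to at most [1]. *)
Lemma near_vertex_hull d (x : 'rV[R]_d) : nonneg x -> mur x <= L%:R ->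
  convex_hull (@near_vertex d) x.
Proof.
have LR := natr_ge2.
move=> x0 hx; pose e i := (step L (d - (i : 'I_d).+1))%:R : R.
have e0 i : 0 < e i by apply: step_gt0.
have -> : x = 0 + \sum_i (x ord0 i / e i) *: (e i *: delta_mx ord0 i).
  rewrite add0r {1}[x]row_sum_delta; apply: eq_bigr => i _.
  by rewrite scalerA divfK// gt_eqF.
apply: convex_simplex.
- split=> [i|i|]; rewrite ?mxE ?int_num0//.
  by left; rewrite mur_zero.
- move=> i; rewrite add0r; split=> [j|j|].
  + by rewrite !mxE rpredM// ?natr_int.
  + by rewrite !mxE mulr_ge0// ltW.
  + by right; rewrite murZ mur_delta mulrC weight_step.
- by move=> i; rewrite divr_ge0// ltW.
- have L0 : 0 < L%:R :> R by lra.
  rewrite -(ler_pM2r L0) mul1r; apply: le_trans hx.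
  rewrite mulr_suml; apply: ler_sum => i _.
  by rewrite -(weight_step R L (d - i.+1)) mulrCA divfK ?gt_eqF.
Qed.

Definition far_vertex k s : set 'rV[R]_(size s).+1 :=
  [set v | [/\ @integer_lattice R _ v, nonneg (tl v), hd v <= (L * k)%:R
     & nur ((k, false) :: s) v = 0 \/ nur ((k, false) :: s) v = L%:R]].

(** The reflection of the newest coordinate carries this corner to the one at the origin. *)
Lemma far_vertex_hull k c s (x : 'rV[R]_(size s).+1) :
  nonneg (tl x) -> hd x <= (L * k)%:R -> nur ((k, c) :: s) x <= L%:R ->
  convex_hull (@far_vertex k s) x.
Proof.
move=> t0 hx nx; rewrite -(reflect_hdK (L * k)%:R x).
apply: (convex_hull_map (A := @near_vertex _)).
- exact: reflect_hd_affine.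
- move=> v [vZ v0 mv]; split; rewrite ?hd_cons ?tl_cons.
  + apply: latticeE; rewrite ?hd_cons ?tl_cons.
      by rewrite rpredB// ?natr_int//; apply: vZ.
    exact: lattice_tl.
  + exact: nonneg_tl.
  + by rewrite gerBl; apply: v0.
  + by rewrite /= hd_cons tl_cons mulr1 subKr -murS.
apply: near_vertex_hull.
  by apply: nonnegE; rewrite ?hd_cons ?tl_cons ?subr_ge0.
by rewrite murS hd_cons tl_cons; rewrite /= mulr1 in nx.
Qed.

(* Both distinguished corners have to be removed for the induction to go
   through: the condition [L <= nur] on the new coordinate amounts, at the
   origin of the old ones, to the condition [L <= mur]. *)
Definition chopped s : set 'rV[R]_(size s) :=
  [set x | [/\ polytope s x, L%:R <= mur x & L%:R <= nur s x]].

Lemma affine_cst d (c : R) : affine_fun (fun _ : 'rV[R]_d => c).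
Proof. by move=> n a v a1; rewrite -mulr_suml a1 mul1r. Qed.

Lemma affineZ d (f : 'rV[R]_d -> R) c :
  affine_fun f -> affine_fun (fun x => c * f x).
Proof.
move=> af n a v a1; rewrite af// mulr_sumr.
by apply: eq_bigr => i _; rewrite mulrCA.
Qed.

Lemma affineB d (f g : 'rV[R]_d -> R) :
  affine_fun f -> affine_fun g -> affine_fun (fun x => f x - g x).
Proof.
move=> af ag n a v a1; rewrite af// ag// -sumrB.
by apply: eq_bigr => i _; rewrite mulrBr.
Qed.

Lemma mur_affine d : affine_fun (fun x : 'rV[R]_d => mur x).
Proof. by move=> n a v _; rewrite mur_sum. Qed.

Lemma chopped_cons k (c : bool) s (y : R) (v : 'rV[R]_(size s)) :
  polytope s v -> 0 <= y <= (L * k)%:R ->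
  (c -> y <= k%:R * nur s v) ->
  L%:R <= (weight L (size s))%:R * y + mur v ->
  L%:R <= (weight L (size s))%:R * ((L * k)%:R - y) + mur v ->
  @integer_lattice R _ v -> y \is a Num.int ->
  (@chopped ((k, c) :: s) `&` @integer_lattice R _) (cons_row y v).
Proof.
move=> pv hy hc m1 n1 vZ yZ; split; last first.
  by apply: latticeE; rewrite ?hd_cons ?tl_cons.
by split; rewrite /= ?murS ?hd_cons ?tl_cons ?mulr1.
Qed.

(** The point [tl x] lies over the near corner, the far corner or the chopped part of the older
    polytope. Each time the ends of the fibre are affine and take integral values at the lattice
    points spanning that piece, so [convex_hull_fiber] applies. *)
Lemma chopped_hull s (x : 'rV[R]_(size s)) : valid s -> chopped x ->
  convex_hull (@chopped s `&` @integer_lattice R _) x.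
Proof.
have LR := natr_ge2.
elim: s x => [|[k c] s IH] x vs.
  by move=> [_]; rewrite mur0; lra.
have /and3P[k2 hc vs'] := vs.
have k2L := height_ge2 k2; have w2 := weight_height_ge (size s) k2.
have kR : 2 <= k%:R :> R by rewrite ler_nat.
have w1 := weight_ge1 (size s).
set w := (weight L (size s))%:R : R in w1 w2 *.
move=> [[/= xs /andP[h0]]]; rewrite !mulr1 murS -/w => h1 hcx mx nx.
have x0 := polytope_nonneg xs.
have [mt|mt] := lerP (mur (tl x)) L%:R.
  (* Here the two new corners bound the fibre: [mur] equals [L] at height [lo], and [nur] does at
     height [hi]. At a near vertex [lo] is [step] or [0]. *)
  pose lo (v : 'rV[R]_(size s)) := w^-1 * (L%:R - mur v).
  pose hi (v : 'rV[R]_(size s)) := (L * k)%:R - lo v.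
  have alo : affine_fun lo.
    by apply: affineZ; apply: affineB; [apply: affine_cst|apply: mur_affine].
  have ahi : affine_fun hi by apply: affineB => //; apply: affine_cst.
  have w0 : 0 < w by lra.
  have wlo v : w * lo v = L%:R - mur v by rewrite /lo mulrA mulfV ?mul1r// gt_eqF.
  apply: (convex_hull_fiber alo ahi _ (near_vertex_hull x0 mt)); last first.
    have := wlo (tl x); rewrite /hi => E.
    by apply/andP; split; rewrite -(ler_pM2l w0) ?mulrBr E; nra.
  move=> v [vZ v0 hv].
  have mv : mur v <= L%:R by case: hv => ->; lra.
  have mv0 := mur_ge0 L v0.
  have lo0 : 0 <= lo v by rewrite -(ler_pM2l w0) mulr0 wlo; lra.
  have loL : lo v <= L%:R by rewrite -(ler_pM2l w0) wlo; nra.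
  have loZ : lo v \is a Num.int.
    rewrite /lo; case: hv => ->; rewrite ?subrr ?mulr0// subr0.
    by rewrite -(weight_step R L (size s)) mulrA mulVf ?mul1r ?natr_int// gt_eqF.
  have pv := polytope_near0 vs' v0 mv.
  have cv y : y <= (L * k)%:R -> c -> y <= k%:R * nur s v.
    move=> yk cT; rewrite cT /= in hc.
    by have := nur_ge_near0 vs' (ltnW hc) v0 mv; rewrite natrM in yk; nra.
  have wl := wlo v.
  have lo1 : 0 <= lo v <= (L * k)%:R by apply/andP; split; lra.
  have hi1 : 0 <= hi v <= (L * k)%:R by rewrite /hi; apply/andP; split; lra.
  split; apply: chopped_cons => //; rewrite -/w.
  - by apply: cv; lra.
  - by rewrite wl; lra.
  - by rewrite mulrBr wl; lra.
  - by apply: cv; rewrite /hi; lra.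
  - by rewrite /hi mulrBr wl; lra.
  - by rewrite /hi subKr wl; lra.
  - by rewrite rpredB// natr_int.
(* When both forms exceed [L] on [tl x], the fibre is all of [[0, L * k]]: the cut is inactive as
   [k * nur >= L * k], and the two new corners stay below [mur = L]. *)
have [nt|nt] := lerP (nur s (tl x)) L%:R; last first.
  apply: (convex_hull_fiber (@affine_cst _ 0) (@affine_cst _ (L * k)%:R) _
    (IH _ vs' _)); last by rewrite h0.
    move=> v [[pv mv nv] vZ]; have v0 := polytope_nonneg pv.
    split; apply: chopped_cons => //; rewrite -/w ?natr_int//.
    + by rewrite lexx; lra.
    + by move=> _; rewrite mulr_ge0//; lra.
    + by rewrite mulr0; lra.
    + by rewrite subr0; lra.
    + by rewrite lexx andbT; lra.
    + by move=> _; rewrite natrM mulrC ler_wpM2l.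
    + by lra.
    + by rewrite subrr mulr0; lra.
  by split => //; apply: ltW.
(* Over the far corner the fibre ends at the cut, if there is one; [nur] is [0] or [L] at the far
   vertices, so [hi] is integral there. *)
pose hi (v : 'rV[R]_(size s)) := if c then k%:R * nur s v else (L * k)%:R.
have ahi : affine_fun hi.
  rewrite /hi; case: (c); last exact: affine_cst.
  by apply: affineZ; apply: nur_affine.
have hxhi : hd x <= hi (tl x) by rewrite /hi; case: (c) hcx => // /(_ isT).
case: s => [|[k' c'] s] in x IH vs hc vs' w w1 w2 xs h0 h1 hcx mx nx x0 mt nt hi ahi hxhi *.
  by move: mt; rewrite mur0; lra.
have /and3P[k2' _ _] := vs'.
have w2' := weight_height_ge (size s) k2'.
have hx' : hd (tl x) <= (L * k')%:R by case: xs => _ /andP[]; rewrite mulr1.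
have tx0 := nonneg_tl x0.
apply: (convex_hull_fiber (@affine_cst _ 0) ahi _
    (far_vertex_hull tx0 hx' nt)); last by rewrite h0.
move=> v [vZ v0 vk hv].
have nv : 0 <= nur ((k', c') :: s) v <= L%:R.
  by rewrite [nur _ _]/=; case: hv => /= ->; apply/andP; split; lra.
have /andP[nv0 nvL] := nv.
have pv := polytope_far vs' v0 vk nvL.
have mv : L%:R <= mur v.
  have m0 := mur_ge0 L v0.
  by move: nvL; rewrite murS /= mulr1; nra.
have hi0 : 0 <= hi v <= (L * k)%:R.
  by rewrite /hi natrM; case: (c); apply/andP; split; nra.
have /andP[hi00 hiL] := hi0.
have whi : 0 <= w * hi v by rewrite mulr_ge0//; lra.
have whi' : 0 <= w * ((L * k)%:R - hi v) by rewrite mulr_ge0 ?subr_ge0//; lra.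
split; apply: chopped_cons => //; rewrite -/w.
- by rewrite lexx; lra.
- by move=> _; rewrite mulr_ge0.
- by rewrite mulr0; lra.
- by rewrite subr0; lra.
- by rewrite /hi => ->.
- by lra.
- by lra.
- rewrite /hi; case: (c); last exact: natr_int.
  rewrite rpredM ?natr_int//.
  by rewrite [nur _ _]/=; case: hv => /= ->; rewrite ?natr_int ?int_num0.
Qed.

(** The two corners and the chopped part cover the polytope, and each lies in the hull of lattice
    points of the polytope. *)
Lemma polytope_hull s : valid s -> (0 < size s)%N ->
  polytope s = convex_hull (polytope s `&` @integer_lattice R _).
Proof.
have LR := natr_ge2.
move=> vs s0; apply/seteqP; split => [x xs|x]; last first.
  move=> [n [v [a [Av a0 a1 ->]]]]; apply: polytope_convex => // i.
  by have [] := Av i.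
have x0 := polytope_nonneg xs.
have [mx|mx] := lerP (mur x) L%:R.
  apply: sub_convex_hull (near_vertex_hull x0 mx) => v [vZ v0 hv].
  split => //; apply: polytope_near0 => //; case: hv => ->; lra.
have [nx|nx] := lerP (nur s x) L%:R; last first.
  apply: sub_convex_hull (chopped_hull vs _) => [v [[pv _ _] vZ]//|].
  by split => //; apply: ltW.
case: s vs s0 x xs x0 mx nx => [//|[k c] s] vs _ x xs x0 mx nx.
have hx : hd x <= (L * k)%:R by case: xs => _ /andP[]; rewrite mulr1.
apply: sub_convex_hull (far_vertex_hull (nonneg_tl x0) hx nx) => v [vZ v0 vk hv].
split => //; apply: polytope_far => //.
by rewrite [nur _ _]/=; case: hv => /= ->; lra.
Qed.

(** The origin and the unit vectors lie in the near corner, as every weight is at most [L]. *)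
Lemma polytope_full s : valid s -> affine_hull (polytope s) = setT.
Proof.
have LR := natr_ge2.
move=> vs; apply/seteqP; split => // x _.
have -> : x = 0 + \sum_i x ord0 i *: delta_mx ord0 i.
  by rewrite add0r {1}[x]row_sum_delta.
apply: affine_simplex => [|i].
  apply: polytope_near0 => // [i|]; first by rewrite mxE.
  by rewrite mur_zero; lra.
rewrite add0r; apply: polytope_near0 => // [j|].
  by rewrite mxE.
by rewrite mur_delta; apply: weight_le.
Qed.

Lemma polytope_integral s : valid s -> (0 < size s)%N ->
  integral_convex_polytope (polytope s).
Proof.
move=> vs s0; exists (polytope s `&` @integer_lattice R _); split.
- by exists (size (pts L s 1)); apply: (@card_lattice_polytope R L s 1).
- by move=> x [].
- exact: polytope_hull.
Qed.

Lemma polytope_Ehrhart s : valid s -> (ehr R L s)`_(size s) != 0 ->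
  is_Ehrhart_polynomial (polytope s) (ehr R L s).
Proof.
move=> vs e0; split.
  apply/eqP; rewrite eqn_leq size_ehr ltnNge.
  by apply: contra e0 => h; rewrite nth_default.
move=> t t0; exists (size (pts L s t)); last exact: horner_ehr.
by rewrite dilate_polytope//; exact: card_lattice_polytope.
Qed.

End Integrality.

(** * Choice of the constants and conclusion *)

Lemma coef1_cornerp_gt (R : realType) (D d : nat) : (2 <= d <= D)%N ->
  (4 * D.+1)%:R < (cornerp R (4 * D.+1) d)`_1.
Proof.
move=> /andP[d2 dD]; rewrite coef1_cornerp; last exact: ltnW.
have dR : 2 <= d%:R :> R by rewrite ler_nat.
have LR : 4 * (d%:R + 1) <= (4 * D.+1)%:R :> R.
  by rewrite natrM ler_pM2l ?ltr0n// natr1 ler_nat.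
set l := (4 * D.+1)%:R in LR *.
rewrite -natr1 -subr_gt0.
(* The factor of [l^2] in [G_1] is [(d - 1) / (2 d (d + 1))], positive for [2 <= d]. Once a factor
   [l] is split off, the claim is linear in [l], and [l >= 4 (d + 1)] settles it. *)
have -> : l ^+ 2 / (d%:R + 1) + (l - l ^+ 2) / 2 / d%:R - l =
    l * (l * (d%:R - 1) + (d%:R + 1) - 2 * d%:R * (d%:R + 1))
      / (2 * d%:R * (d%:R + 1)).
  by field; apply/andP; split; rewrite gt_eqF//; lra.
apply: divr_gt0; last by nra.
apply: mulr_gt0; first by lra.
have : 4 * (d%:R + 1) * (d%:R - 1) <= l * (d%:R - 1).
  by apply: ler_wpM2r => //; lra.
nra.
Qed.

Theorem theorem1p7 (R : realType) (d : nat) (hd : (3 <= d)%N)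
    (s : seq nat) (hs : sorted ltn s)
    (hbound : forall i : nat, i \in s -> (1 <= i <= d - 2)%N) :
  exists P : set 'rV[R]_d,
    [/\ integral_convex_polytope P,
        full_dimensional P
      & exists p : {poly R},
          [/\ is_Ehrhart_polynomial P p,
              forall i : nat, i \in s -> p`_i < 0
            & forall j : nat, (j <= d)%N -> j \notin s -> 0 < p`_j]].
Proof.
pose L := (4 * d.+1)%N; have L2 : (2 <= L)%N by rewrite /L; lia.
(* One bound for all coefficients of [cornerp] in all dimensions up to [d]; those of index at least
   [e.+2] vanish. *)
pose M : R := \sum_(e < d.+1) \sum_(j < e.+2) `|(cornerp R L e)`_j|.
have M0 : 0 <= M by apply: sumr_ge0 => e _; apply: sumr_ge0.
have hM e j : (e <= d)%N -> `|(cornerp R L e)`_j| <= M.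
  move=> ed; have [ej|je] := leqP e.+2 j.
    by rewrite nth_default ?normr0// (leq_trans (size_cornerp _ _ _)).
  rewrite /M (bigD1 (Ordinal (ed : (e < d.+1)%N)))//=.
  rewrite (bigD1 (Ordinal je))//= -addrA lerDl addr_ge0//.
    exact: sumr_ge0.
  by apply: sumr_ge0 => i _; apply: sumr_ge0.
have hL e : (2 <= e <= d)%N -> L%:R < (cornerp R L e)`_1 by apply: coef1_cornerp_gt.
have d2 : (2 <= d <= d)%N by rewrite leqnn ltnW.
have [q [qd vq hq]] := exists_ehr_signs L2 M0 hL hM d2 hbound.
have {hq} hq j : (1 <= j <= d)%N -> 0 < (-1) ^+ (j \in s) * (ehr R L q)`_j.
  by move=> /hq; apply: le_lt_trans.
have sP j : j \in s -> (1 <= j <= d)%N by move=> /hbound; lia.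
have vE : is_Ehrhart_polynomial (@polytope R L q 1) (ehr R L q).
  apply: polytope_Ehrhart => //; have := hq d; rewrite qd leqnn ltnW ?(ltnW hd)//.
  by move=> /(_ isT); apply: contraTneq => ->; rewrite mulr0 ltxx.
have q0 : (0 < size q)%N by rewrite qd; lia.
have vI := polytope_integral R L2 vq q0; have vF := polytope_full R L2 vq.
have e0 := coef0_ehr R L vq.
(* The polytope lives in dimension [size q]; generalising it together with its polynomial allows
   rewriting that dimension to [d]. *)
move: hq vE vI vF e0; move: (@polytope R L q 1) (ehr R L q).
rewrite qd => P p hq vE vI vF e0; exists P; split => //; exists p; split => //.
  by move=> i si; have := hq i (sP i si); rewrite si expr1 mulN1r oppr_gt0.
move=> [|j] jd sj; first by rewrite e0.
by have := hq j.+1; rewrite (negPf sj) expr0 mul1r; apply.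
Qed.
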